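(* Let $n\ge2$ be an integer with distinct prime divisors $p_1,\dots,p_k$. Let $a,a'$ be squarefree integers with $a\equiv a'\pmod{np_1\cdots p_k}$, and let $\theta,\theta'$ be roots of $x^n-a$ and $x^n-a'$ respectively such that $K=\mathbb{Q}(\theta)$ and $K'=\mathbb{Q}(\theta')$ both have degree $n$ over $\mathbb{Q}$. Then for all integers $c_0,\dots,c_{n-1}$ and nonzero integers $q$, the element $\frac1q(c_0+c_1\theta+\cdots+c_{n-1}\theta^{n-1})$ lies in $A_K$ if and only if $\frac1q(c_0+c_1\theta'+\cdots+c_{n-1}\theta'^{\,n-1})$ lies in $A_{K'}$.
   Context: $A_K$ denotes the ring of algebraic integers of the number field $K$. *)

(* Defs.v *)
From mathcomp Require Import all_boot all_order all_algebra all_field.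
Set Implicit Arguments.
Unset Strict Implicit.
Unset Printing Implicit Defensive.
Import GRing.Theory.
Local Open Scope ring_scope.

(* In particular 0 is not squarefree, while 1 and -1 are. *)
Definition squarefreez (a : int) : Prop :=
  forall d : int, (d ^+ 2 %| a)%Z -> d \is a GRing.unit.

(* Number fields are abstract finite extensions of [rat]; this is the predicate
   "belongs to A_K". *)
Definition algebraic_integer (K : fieldExtType rat) (x : K) : Prop :=
  integralOver (intr : int -> K) x.

(* Main.v *)
Require Import Defs.
From mathcomp Require Import all_boot all_order all_algebra all_field.
From mathcomp Require Import ring zify.
Import GRing.Theory Num.Theory.
Local Open Scope ring_scope.

(* Let [x_k] run over the complex roots of [X^n - a], let [w^n = a'], and let
   [g] be the rational polynomial of degree < n in question.  As [X^n - a] is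
   irreducible, integrality of [g(theta)] means that all [g(x_k)] are algebraic
   integers.  Lagrange interpolation at the [x_k] gives
     [a * g(w) = \sum_k x_k * g(x_k) * (a' - a) / (n * (w - x_k))],
   and the congruence makes each [(a' - a) / (n * (w - x_k))] an algebraic
   integer, whence so is [a * g(w)].  The factor [a] is removed with Eisenstein's
   argument: the primes dividing the squarefree [a] do not occur in the
   denominator of [g]. *)

(** * Integrality of the difference quotients *)

(** Prime by prime: [i * 'C(n, i) = n * 'C(n.-1, i.-1)] shows that ['C(n, i)] lacks at most
    [logn p i] factors [p], and the radical supplies [i.-1] of them, enough because
    [p ^ logn p i <= i]. *)
Lemma dvdn_bin_radX (n i : nat) : (0 < n)%N -> (0 < i)%N ->
  (n %| 'C(n, i) * (\prod_(p <- primes n) p) ^ i.-1)%N.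
Proof.
move=> n_gt0 i_gt0; have [le_in|lt_ni] := leqP i n; last by rewrite bin_small.
have C_gt0 : (0 < 'C(n, i))%N by rewrite bin_gt0.
have rad_gt0 : (0 < \prod_(p <- primes n) p)%N.
  by rewrite big_seq prodn_cond_gt0 // => p; rewrite mem_primes => /andP[/prime_gt0].
apply/dvdn_partP => // p p_n; rewrite p_part.
have /[!mem_primes]/andP[p_pr _] : p \in primes n by [].
rewrite pfactor_dvdn // ?muln_gt0 ?C_gt0 ?expn_gt0 ?rad_gt0 //.
rewrite lognM ?expn_gt0 ?rad_gt0 // lognX.
have rad_p : (0 < logn p (\prod_(p <- primes n) p))%N.
  by rewrite logn_gt0 mem_primes p_pr rad_gt0 (big_rem p) //= dvdn_mulr.
have i_p : (logn p i <= i.-1)%N.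
  suff : (logn p i < i)%N by lia.
  apply: leq_trans (ltn_expl _ (prime_gt1 p_pr)) _.
  by rewrite dvdn_leq ?pfactor_dvdnn.
have : (logn p n <= logn p i + logn p 'C(n, i))%N.
  rewrite -lognM //; apply: dvdn_leq_log; first by rewrite muln_gt0 i_gt0.
  by rewrite -[i](prednK i_gt0) -mul_bin_diag dvdn_mulr.
by nia.
Qed.

Lemma AintP (x : algC) : x \in Aint <-> integralOver (intr : int -> algC) x.
Proof.
split=> [| [p p_mon px]].
  rewrite unfold_in => /floorpP[p def_p].
  have [q [def_q q_mon] root_q] := minCpolyP x.
  (* The integer lift of the minimal polynomial is the monic witness. *)
  exists p; last by rewrite -def_p def_q root_q dvdpp.
  apply/eqP/(@intr_inj algC).
  rewrite -(@lead_coef_map_inj _ _ intr) ?rmorph0 //; last exact: intr_inj.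
  by rewrite -def_p def_q lead_coef_map (eqP q_mon) !rmorph1.
apply: root_monic_Aint px _ _; first by rewrite monic_map.
by apply/polyOverP => i; rewrite coef_map intr_int.
Qed.

Lemma root_monic_over_Aint (p : {poly algC}) (x : algC) :
  p \is monic -> p \is a polyOver Aint -> root p x -> x \in Aint.
Proof.
move=> p_mon /polyOverP Ap px; apply/AintP.
by apply: integral_root_monic p_mon px _ => _ /(nthP 0)[i _ <-]; apply/AintP.
Qed.

Lemma Aint_int_root (n : nat) (a : int) (x : algC) :
  (0 < n)%N -> x ^+ n = a%:~R -> x \in Aint.
Proof.
move=> n_gt0 x_n.
apply: (@root_monic_over_Aint ('X^n - (a%:~R)%:P)); first exact: monicXnsubC.
  by rewrite rpredB ?rpredX ?polyOverX // polyOverC Aint_int.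
by rewrite /root !hornerE x_n subrr.
Qed.

(* With [g := (y ^+ n - x ^+ n) / (n * (y - x))] and [r] the radical of [n],
   the binomial expansion of [(x + r * d / g) ^+ n] is, up to a factor, a monic
   equation for [g] whose coefficients
   [('C(n, i) * r ^+ i.-1 / n) * d ^+ i.-1 * x ^+ (n - i)] are integral. *)
Lemma Aint_diff_quotient (n : nat) (d : int) (x y : algC) : (0 < n)%N ->
    x \in Aint -> y != x ->
    y ^+ n - x ^+ n = (n * \prod_(p <- primes n) p)%:R * d%:~R ->
  (y ^+ n - x ^+ n) / (n%:R * (y - x)) \in Aint.
Proof.
move=> n_gt0 Ax neq_yx; set r := (\prod_(p <- primes n) p)%N => def_d.
have n_neq0 : (n%:R : algC) != 0 by rewrite pnatr_eq0 -lt0n.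
set b := y - x; have b_neq0 : b != 0 by rewrite subr_eq0.
set g := _ / _; have gb : g * b = r%:R * d%:~R.
  by rewrite /g def_d natrM; field; rewrite b_neq0 n_neq0.
pose e j := ('C(n, n - j) * r ^ (n - j).-1 %/ n)%N.
have neE j : (j < n)%N -> (n * e j)%N = ('C(n, n - j) * r ^ (n - j).-1)%N.
  by move=> lt_jn; rewrite mulnC divnK // dvdn_bin_radX // subn_gt0.
pose s := \poly_(j < n) ((e j)%:R * d%:~R ^+ (n - j).-1 * x ^+ j).
have size_s : (size (- s)%R < size ('X^n : {poly algC}))%N.
  by rewrite size_polyN size_polyXn ltnS size_poly.
apply: (@root_monic_over_Aint ('X^n - s)).
- by rewrite monicE lead_coefDl // lead_coefXn.
- apply/polyOverP => i; rewrite coefB coefXn coef_poly.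
  rewrite rpredB ?rpred_nat //; case: ifP => _; last exact: rpred0.
  by rewrite !rpredM ?rpred_nat ?rpredX // Aint_int.
rewrite /root !hornerE horner_poly subr_eq0; apply/eqP.
apply: (mulfI (mulf_neq0 n_neq0 (expf_neq0 n b_neq0))).
rewrite -mulrA -exprMn [b * g]mulrC gb mulr_sumr.
(* After multiplication by [n * b ^+ n], both sides of the equation for [g] equal this; the right
   one by expanding [(b + x) ^+ n], whose last term cancels [x ^+ n]. *)
transitivity ((r%:R * d%:~R) ^+ n.-1 * (y ^+ n - x ^+ n)).
  by rewrite def_d natrM -{2}(prednK n_gt0) exprS; ring.
have -> : y = b + x by rewrite subrK.
rewrite exprDn big_ord_recr /= subnn expr0 mul1r binn mulr1n addrK mulr_sumr.
apply: eq_bigr => -[j lt_jn] _ /=.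
have -> : n%:R * b ^+ n * ((e j)%:R * d%:~R ^+ (n - j).-1 * x ^+ j * g ^+ j) =
   (n * e j)%:R * d%:~R ^+ (n - j).-1 * x ^+ j * (g * b) ^+ j * b ^+ (n - j).
  have -> : b ^+ n = b ^+ (n - j) * b ^+ j by rewrite -exprD subnK // ltnW.
  by rewrite natrM (_ : (g * b) ^+ j = g ^+ j * b ^+ j); [ring | rewrite exprMn].
rewrite neE // gb bin_sub 1?ltnW // natrM natrX -mulr_natl !exprMn.
have -> : n.-1 = ((n - j).-1 + j)%N by lia.
by rewrite !exprD; ring.
Qed.

(** * Lagrange interpolation at the roots of [X^n - a] *)

Lemma sum_prim_rootX (F : fieldType) (n m : nat) (z : F) :
  n.-primitive_root z -> \sum_(k < n) z ^+ (k * m) = if (n %| m)%N then n%:R else 0.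
Proof.
move=> prim_z; have z_n := prim_expr_order prim_z.
under eq_bigr do rewrite mulnC exprM.
rewrite (prim_order_dvd prim_z); case: eqP => [zm1|/eqP zm_neq1].
  under eq_bigr do rewrite zm1 expr1n.
  by rewrite sumr_const card_ord.
rewrite -subr_eq0 in zm_neq1.
have := subrX1 (z ^+ m) n; rewrite exprAC z_n expr1n subrr => /esym/eqP.
by rewrite mulf_eq0 (negPf zm_neq1) => /eqP.
Qed.

(** At the nodes [x_k = z ^+ k * x] the Lagrange denominators are
    [n * x_k ^+ n.-1 = n * x ^+ n / x_k], whence the factor on the left and the exponent [i.+1].
    Expanding the quotients as geometric sums reduces the identity to orthogonality of roots of
    unity. *)
Lemma lagrange_roots (F : fieldType) (n i : nat) (z x y : F) :
    n.-primitive_root z -> y ^+ n != x ^+ n -> (i < n)%N ->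
  n%:R * x ^+ n * y ^+ i =
  \sum_(k < n) (z ^+ k * x) ^+ i.+1 * ((y ^+ n - x ^+ n) / (y - z ^+ k * x)).
Proof.
move=> prim_z neq_xy lt_in; have z_n := prim_expr_order prim_z.
have zx_n k : (z ^+ k * x) ^+ n = x ^+ n.
  by rewrite exprMn exprAC z_n expr1n mul1r.
transitivity (\sum_(k < n) \sum_(j < n)
    y ^+ (n.-1 - j) * x ^+ (i.+1 + j) * z ^+ (k * (i.+1 + j))); last first.
  apply: eq_bigr => k _; rewrite -(zx_n k) subrXX mulrAC.
  rewrite divff ?mul1r; last first.
    by apply: contraNneq neq_xy => /eqP/[!subr_eq0]/eqP->; rewrite zx_n.
  rewrite mulr_sumr; apply: eq_bigr => j _.
  by rewrite mulrCA -exprD exprMn -exprM; ring.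
rewrite exchange_big /=; under eq_bigr do rewrite -mulr_sumr (sum_prim_rootX _ _ _ _ prim_z).
(* Since [1 <= i.+1 + j < 2 * n], only the index with [i.+1 + j = n] survives. *)
have lt_jn : (n.-1 - i < n)%N by lia.
rewrite (bigD1 (Ordinal lt_jn)) //= big1 => [|j].
  have -> : (i.+1 + (n.-1 - i) = n)%N by lia.
  have -> : (n.-1 - (n.-1 - i) = i)%N by lia.
  by rewrite dvdnn; ring.
rewrite -val_eqE /= => neq_j; case: ifPn => [/dvdnP[c def_c]|_]; last by rewrite mulr0.
by have := ltn_ord j; case: c def_c => [|[|c]]; nia.
Qed.

Lemma Aint_pure_transfer (n : nat) (a a' : int) (w : algC) (b : 'I_n -> algC) :
    (0 < n)%N -> a != 0 ->
    (a = a' %[mod Posz (n * \prod_(p <- primes n) p)%N])%Z ->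
    w ^+ n = a'%:~R ->
    (forall z, z ^+ n = a%:~R -> \sum_(i < n) b i * z ^+ i \in Aint) ->
  a%:~R * (\sum_(i < n) b i * w ^+ i) \in Aint.
Proof.
move=> n_gt0 a_neq0 a_a' w_n Ab.
(* If [a' = a], then [w] is itself a node and the hypothesis applies to it directly. *)
have [eq_a|neq_a] := eqVneq a' a.
  by rewrite rpredM ?Aint_int // Ab // w_n eq_a.
have /dvdzP[d def_d] : (Posz (n * \prod_(p <- primes n) p)%N %| a' - a)%Z.
  by rewrite -eqz_mod_dvd; apply/eqP.
have n_neq0 : (n%:R : algC) != 0 by rewrite pnatr_eq0 -lt0n.
pose z := n.-root (a%:~R : algC).
have z_n : z ^+ n = a%:~R by rewrite rootCK.
have [zeta prim_zeta] := C_prim_root_exists n_gt0.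
have neq_wz : w ^+ n != z ^+ n.
  by rewrite w_n z_n (inj_eq (@intr_inj algC)).
pose x k := zeta ^+ k * z.
have x_n k : x k ^+ n = a%:~R.
  by rewrite /x exprMn exprAC (prim_expr_order prim_zeta) expr1n mul1r.
have Ax k : x k \in Aint := Aint_int_root n a (x k) n_gt0 (x_n k).
have -> : a%:~R * (\sum_(i < n) b i * w ^+ i) =
    \sum_(k < n) (x k * (\sum_(i < n) b i * x k ^+ i)) *
      ((w ^+ n - x k ^+ n) / (n%:R * (w - x k))).
  apply: (mulfI n_neq0); rewrite mulrA !mulr_sumr.
  under eq_bigr => i _ do
    rewrite -z_n mulrCA (lagrange_roots _ _ _ _ _ _ prim_zeta neq_wz) // mulr_sumr.
  rewrite exchange_big /=; apply: eq_bigr => k _.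
  rewrite mulr_sumr mulr_suml mulr_sumr; apply: eq_bigr => i _.
  have wx : w - x k != 0.
    by rewrite subr_eq0; apply: contraNneq neq_wz => ->; rewrite x_n z_n.
  rewrite -/(x k) z_n x_n exprS; set v := x k ^+ i.
  by field; rewrite wx n_neq0.
rewrite rpred_sum // => k _; apply: rpredM; first by rewrite rpredM ?Ab.
apply: (Aint_diff_quotient n d) => //.
  by apply: contraNneq neq_wz => ->; rewrite x_n z_n.
by rewrite w_n x_n -rmorphB def_d mulrC rmorphM.
Qed.

(** * Removing the factor [a] *)

(* As in Eisenstein's criterion: multiplying by [z ^+ (n - 1 - i)] isolates the
   first coefficient not known to be divisible by [p]; its [n]-th power is rational. *)
Lemma Aint_eisenstein (n p : nat) (a : int) (z : algC) (x : 'I_n -> int) :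
    prime p -> (p %| a)%Z -> ~~ (Posz p ^+ 2 %| a)%Z -> z ^+ n = a%:~R ->
    p%:R^-1 * (\sum_(i < n) (x i)%:~R * z ^+ i) \in Aint ->
  forall i, (p %| x i)%Z.
Proof.
move=> p_pr /dvdzP[u def_a] p2_a z_n; set t := _ * _ => At [i lt_in].
have p_neq0 : (p%:R : algC) != 0 by rewrite pnatr_eq0 -lt0n prime_gt0.
have Ap (m : int) : (p %| m)%Z -> p%:R^-1 * m%:~R \in Aint.
  by case/dvdzP=> c ->; rewrite rmorphM mulrCA mulVf // mulr1 Aint_int.
have n_gt0 : (0 < n)%N by case: (n) lt_in.
have Az : z \in Aint := Aint_int_root n a z n_gt0 z_n.
have p_u : ~~ (p %| `|u|)%N.
  apply: contra p2_a; rewrite def_a -[(p %| _)%N]/(Posz p %| u)%Z => p_u.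
  by rewrite expr2 dvdz_mul.
elim/ltn_ind: i lt_in => i IHi lt_in; set xi := x _.
have Axi : p%:R^-1 * xi%:~R * z ^+ n.-1 \in Aint.
  have -> : p%:R^-1 * xi%:~R * z ^+ n.-1 = t * z ^+ (n.-1 - i) -
      \sum_(j < n | j != Ordinal lt_in)
         p%:R^-1 * (x j)%:~R * z ^+ (j + (n.-1 - i)).
    rewrite /t (bigD1 (Ordinal lt_in)) //= mulrDr mulrDl -addrA mulr_sumr mulr_suml.
    rewrite [X in _ + X](_ : _ = 0) ?addr0; last first.
      by rewrite -sumrB big1 // => j _; rewrite exprD; ring.
    have -> : n.-1 = (i + (n.-1 - i))%N by lia.
    by rewrite addKn exprD; ring.
  apply: rpredB; first by rewrite rpredM ?rpredX.
  apply: rpred_sum => -[j lt_jn].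
  rewrite -val_eqE neq_ltn /= => /orP[lt_ji|lt_ij].
    by rewrite rpredM ?rpredX // Ap // IHi.
  (* For [j > i] the exponent reaches [n], and [z ^+ n = a] absorbs the denominator [p]. *)
  have -> : (j + (n.-1 - i) = n + (j - i.+1))%N by lia.
  rewrite mulrAC exprD z_n mulrA; apply: rpredM (Aint_int _).
  by apply: rpredM (rpredX _ Az); rewrite Ap // def_a dvdz_mull.
have := rpredX n Axi; rewrite !exprMn -exprM mulnC exprM z_n exprVn => Axn.
have Qxn : (p%:R ^+ n)^-1 * xi%:~R ^+ n * a%:~R ^+ n.-1 \in Crat.
  by rewrite !rpredM ?rpredV ?rpredX ?rpred_nat ?rpred_int.
have /intrP[m def_m] := Cint_rat_Aint Qxn Axn.
have {}def_m : xi ^+ n * a ^+ n.-1 = m * Posz p ^+ n.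
  apply: (@intr_inj algC); rewrite !rmorphM !rmorphXn /= -def_m.
  by field; rewrite expf_neq0.
rewrite dvdzE; apply: contraR p_u => p_xi.
(* With [a = u * p], cancelling [p ^ n.-1] leaves a multiple of [p] equal to
   [|xi| ^ n * |u| ^ n.-1]. *)
have /eqP := congr1 absz def_m; rewrite def_a !(abszM, abszX) /= expnMn.
rewrite -[in X in _ == X](prednK n_gt0) expnS !mulnA.
rewrite eqn_pmul2r ?expn_gt0 ?prime_gt0 // => /eqP def_p.
have : (p %| `|xi| ^ n * `|u| ^ n.-1)%N by rewrite def_p dvdn_mull.
by rewrite Euclid_dvdM // !Euclid_dvdX // (negPf p_xi) => /andP[].
Qed.

(** Descent on [|q|]: if [q] is coprime to [a], a Bezout relation removes [a]; otherwise a common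
    prime [p] divides every [c i] by [Aint_eisenstein], and is cancelled from [q] and [c]. *)
Lemma Aint_pure_congr (n : nat) (a a' : int) (w : algC) (c : 'I_n -> int) (q : int) :
    (0 < n)%N -> squarefreez a ->
    (a = a' %[mod Posz (n * \prod_(p <- primes n) p)%N])%Z ->
    w ^+ n = a'%:~R -> q != 0 ->
    (forall z, z ^+ n = a%:~R -> q%:~R^-1 * (\sum_(i < n) (c i)%:~R * z ^+ i) \in Aint) ->
  q%:~R^-1 * (\sum_(i < n) (c i)%:~R * w ^+ i) \in Aint.
Proof.
move=> n_gt0 sqf_a a_a' w_n q_neq0 Ac.
have a_neq0 : a != 0 by apply/eqP => a0; have := sqf_a 2; rewrite a0 dvdz0 => /(_ isT).
have qE x : q%:~R^-1 * (\sum_(i < n) (c i)%:~R * x ^+ i) =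
    \sum_(i < n) (q%:~R^-1 * (c i)%:~R) * x ^+ i :> algC.
  by rewrite mulr_sumr; under eq_bigr do rewrite mulrA.
have: a%:~R * (q%:~R^-1 * (\sum_(i < n) (c i)%:~R * w ^+ i)) \in Aint.
  rewrite qE; apply: Aint_pure_transfer a_a' w_n _ => // z z_n.
  by rewrite -qE Ac.
pose z := n.-root (a%:~R : algC).
have z_n : z ^+ n = a%:~R by rewrite rootCK.
have Aw : w \in Aint := Aint_int_root n a' w n_gt0 w_n.
(* From here integrality at the single root [z] suffices. *)
move: {Ac qE} (Ac z z_n).
have [m] := ubnP `|q|%N; elim: m => // m IHm in q c q_neq0 *.
rewrite ltnS => le_qm Az Aaw.
have q_neq0C : q%:~R != 0 :> algC by rewrite intr_eq0.
have [|not_coprime] := boolP (coprimez a q).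
  case/coprimezP=> -[u v] /= /(congr1 (fun m : int => m%:~R : algC)).
  rewrite rmorphD !rmorphM rmorph1 => uv; set s := \sum_(i < n) _.
  have -> : q%:~R^-1 * s = u%:~R * (a%:~R * (q%:~R^-1 * s)) + v%:~R * s.
    by rewrite -[LHS]mul1r -{1}uv; field.
  apply: rpredD; first by rewrite rpredM ?Aint_int.
  apply: rpredM (Aint_int _) _; apply: rpred_sum => i _.
  by rewrite rpredM ?Aint_int ?rpredX.
have g_gt1 : (1 < gcdn `|a| `|q|)%N.
  by rewrite ltn_neqAle eq_sym -[_ == _]coprimezE not_coprime gcdn_gt0 !absz_gt0 a_neq0.
have p_pr := pdiv_prime g_gt1; set p := pdiv _ in p_pr.
have [p_a p_q] : (p %| a)%Z /\ (p %| q)%Z.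
  by apply/andP; rewrite !dvdzE /= -dvdn_gcd pdiv_dvd.
have p2_a : ~~ (Posz p ^+ 2 %| a)%Z.
  by apply/negP => /sqf_a; case: (p) p_pr => [|[|]].
have /dvdzP[q' def_q] := p_q.
have p_neq0 : (p%:R : algC) != 0 by rewrite pnatr_eq0 -lt0n prime_gt0.
have p_c : forall i, (p %| c i)%Z.
  apply: (@Aint_eisenstein n p a z) => //.
  suff -> : p%:R^-1 = q'%:~R * q%:~R^-1 :> algC.
    by rewrite -mulrA rpredM ?Aint_int.
  move: q_neq0C; rewrite def_q rmorphM /= mulf_eq0 => /norP[q'_neq0 _].
  by rewrite invfM mulrA divff // mul1r.
pose c' i := (c i %/ p)%Z.
have pE x : q%:~R^-1 * (\sum_(i < n) (c i)%:~R * x ^+ i) =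
    q'%:~R^-1 * (\sum_(i < n) (c' i)%:~R * x ^+ i) :> algC.
  rewrite def_q rmorphM /= invfM -mulrA; congr (_ * _); rewrite mulr_sumr.
  apply: eq_bigr => i _; rewrite -[in LHS](divzK (p_c i)) rmorphM /= -/(c' i).
  by field.
rewrite !pE in Az Aaw *; apply: IHm => //.
  by apply: contraNneq q_neq0; rewrite def_q => ->; rewrite mul0r.
apply: leq_trans le_qm; rewrite def_q abszM ltn_Pmulr ?prime_gt1 // absz_gt0.
by apply: contraNneq q_neq0; rewrite def_q => ->; rewrite mul0r.
Qed.

(** * From number fields to complex roots *)

(** If [f] does not divide [g], irreducibility makes them coprime, and coprimality survives [phi],
    excluding a common root. *)
Lemma root_irreducible (F L : fieldType) (phi : {rmorphism F -> L})
    (f g : {poly F}) (x : L) :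
    irreducible_poly f -> root (map_poly phi f) x ->
  root (map_poly phi g) x = (f %| g).
Proof.
move=> [f_gt1 irr_f] fx; apply/idP/idP => [gx | /dvdpP[h ->]]; last first.
  by rewrite rmorphM rootM fx orbT.
have [g1|g_neq1] := boolP (coprimep f g).
  move: g1; rewrite -(coprimep_map phi) => /coprimep_root/(_ fx).
  by rewrite (rootP gx) eqxx.
by have /eqp_dvdl <- := irr_f _ g_neq1 (dvdp_gcdl f g); rewrite dvdp_gcdr.
Qed.

(** A monic integer [p] kills the value of [g] at a root of [f] exactly when [f] divides [p \Po g]
    over the rationals, a condition independent of the field and of the root; so the same [p] serves
    for [x']. *)
Lemma integralOver_horner_conjugate (L L' : fieldType)
    (phi : {rmorphism rat -> L}) (phi' : {rmorphism rat -> L'})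
    (f g : {poly rat}) (x : L) (x' : L') :
    irreducible_poly f -> root (map_poly phi f) x -> root (map_poly phi' f) x' ->
    integralOver (intr : int -> L) (map_poly phi g).[x] ->
  integralOver (intr : int -> L') (map_poly phi' g).[x'].
Proof.
have rootE (M : fieldType) (psi : {rmorphism rat -> M}) (p : {poly int}) (y : M) :
    root (map_poly intr p) (map_poly psi g).[y] =
    root (map_poly psi (map_poly intr p \Po g)) y.
  rewrite map_comp_poly root_comp -map_poly_comp; congr (root _ _).
  by apply: eq_map_poly => m /=; rewrite rmorph_int.
move=> irr_f fx fx' [p p_mon]; rewrite rootE (root_irreducible _ _ _ _ _ _ irr_f) // => f_p.
by exists p; rewrite // rootE (root_irreducible _ _ _ _ _ _ irr_f).
Qed.

Lemma map_poly_pure (F L : fieldType) (phi : {rmorphism F -> L}) (n : nat) (a : int) :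
  map_poly phi ('X^n - (a%:~R)%:P) = 'X^n - (a%:~R)%:P.
Proof. by rewrite rmorphB /= map_polyXn map_polyC /= rmorph_int. Qed.

(** In a factorization [e * d], one factor vanishes at [theta], whose minimal polynomial has degree
    [n]; that factor has full degree and the other is constant. *)
Lemma irreducible_pure (n : nat) (a : int) (K : fieldExtType rat) (theta : K) :
    (0 < n)%N -> root ('X^n - (a%:~R)%:P) theta ->
    <<1; theta>>%VS = fullv -> \dim {:K} = n ->
  irreducible_poly ('X^n - (a%:~R)%:P : {poly rat}).
Proof.
move=> n_gt0 theta_n gen_theta deg_K.
set f := _ - _; have f_n : size f = n.+1 by rewrite size_XnsubC.
have f_neq0 : f != 0 by rewrite -size_poly_gt0 f_n.
have small (g : {poly rat}) : root (map_poly (in_alg K) g) theta -> g != 0 -> (n < size g)%N.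
  move=> g_theta g_neq0.
  have g1 : map_poly (in_alg K) g \is a polyOver 1%VS by apply/polyOver1P; exists g.
  have := dvdp_leq _ (minPoly_dvdp g1 g_theta).
  rewrite size_map_poly map_poly_eq0 g_neq0 size_minPoly adjoin_degreeE gen_theta.
  by rewrite dimv1 divn1 deg_K => ->.
split=> [|d d_neq1 /dvdpP[e def_f]]; first by rewrite f_n ltnS.
have [e_neq0 d_neq0] : e != 0 /\ d != 0.
  by apply/andP; rewrite -negb_or -mulf_eq0 -def_f.
have size_ed : (size e + size d = n.+2)%N.
  have := size_mul e_neq0 d_neq0; rewrite -def_f f_n => ->.
  by rewrite prednK // addn_gt0 size_poly_gt0 e_neq0.
have : root (map_poly (in_alg K) (e * d)) theta.
  by rewrite -def_f map_poly_pure.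
rewrite rmorphM rootM => /orP[/small/(_ e_neq0)|/small/(_ d_neq0)] lt_n.
  move: d_neq1 size_ed lt_n d_neq0; rewrite -size_poly_gt0 /=.
  by move: (size d) (size e); lia.
rewrite -dvdp_size_eqp ?f_n; last by rewrite def_f dvdp_mull.
move: size_ed lt_n e_neq0; rewrite -size_poly_gt0 /=.
by move: (size d) (size e); lia.
Qed.

(** By irreducibility [theta] is conjugate to every complex root [z], so integrality may be tested
    at any one of them and then holds at all. *)
Lemma algebraic_integer_pure (n : nat) (a : int) (K : fieldExtType rat) (theta : K)
    (z : algC) (c : 'I_n -> int) (q : int) :
    (0 < n)%N -> root ('X^n - (a%:~R)%:P) theta ->
    <<1; theta>>%VS = fullv -> \dim {:K} = n -> z ^+ n = a%:~R ->
  algebraic_integer (q%:~R^-1 * \sum_(i < n) (c i)%:~R * theta ^+ i) <->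
  q%:~R^-1 * (\sum_(i < n) (c i)%:~R * z ^+ i) \in Aint.
Proof.
move=> n_gt0 theta_n gen_theta deg_K z_n.
pose f := 'X^n - (a%:~R)%:P : {poly rat}.
pose g := (q%:~R^-1)%:P * \sum_(i < n) (c i)%:~R%:P * 'X^i : {poly rat}.
have irr_f : irreducible_poly f by apply: irreducible_pure theta_n gen_theta deg_K.
have gE (L : fieldType) (phi : {rmorphism rat -> L}) (x : L) :
    (map_poly phi g).[x] = q%:~R^-1 * \sum_(i < n) (c i)%:~R * x ^+ i.
  rewrite rmorphM /= map_polyC /= fmorphV rmorph_int hornerM hornerC rmorph_sum.
  rewrite horner_sum; congr (_ * _); apply: eq_bigr => i _.
  by rewrite rmorphM /= map_polyC map_polyXn /= rmorph_int !hornerE.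
have f_theta : root (map_poly (in_alg K) f) theta by rewrite map_poly_pure.
have f_z : root (map_poly (ratr : rat -> algC) f) z.
  by rewrite map_poly_pure /root !hornerE z_n subrr.
rewrite AintP /algebraic_integer -(gE _ (in_alg K)) -(gE _ (ratr : {rmorphism rat -> algC})).
by split; apply: integralOver_horner_conjugate irr_f _ _.
Qed.

Theorem theorem1p5 (n : nat) (n_ge2 : (2 <= n)%N) (a a' : int)
    (sqf_a : squarefreez a) (sqf_a' : squarefreez a')
    (a_a' : (a = a' %[mod Posz (n * \prod_(p <- primes n) p)%N])%Z)
    (K K' : fieldExtType rat) (theta : K) (theta' : K')
    (root_theta : root ('X^n - (a%:~R)%:P) theta)
    (root_theta' : root ('X^n - (a'%:~R)%:P) theta')
    (gen_theta : <<1; theta>>%VS = fullv)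
    (gen_theta' : <<1; theta'>>%VS = fullv)
    (deg_K : \dim {:K} = n) (deg_K' : \dim {:K'} = n)
    (c : 'I_n -> int) (q : int) (q_neq0 : q != 0) :
  algebraic_integer (q%:~R^-1 * \sum_(i < n) (c i)%:~R * theta ^+ i) <->
  algebraic_integer (q%:~R^-1 * \sum_(i < n) (c i)%:~R * theta' ^+ i).
Proof.
have n_gt0 := ltnW n_ge2.
have z_n (b : int) : (n.-root b%:~R : algC) ^+ n = b%:~R by rewrite rootCK.
have toC := algebraic_integer_pure n a K theta _ c q n_gt0 root_theta gen_theta deg_K.
have toC' := algebraic_integer_pure n a' K' theta' _ c q n_gt0 root_theta' gen_theta' deg_K'.
(* The conclusion is tested at one chosen root, while the assumption is used at every root, as
   [Aint_pure_congr] requires. *)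
split=> [Ac | Ac'].
  apply/(toC' _ (z_n a'))/(Aint_pure_congr n a a') => // z /toC[+ _]; exact.
apply/(toC _ (z_n a))/(Aint_pure_congr n a' a) => // z /toC'[+ _]; exact.
Qed.
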